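(* Let $F$ be a field with a nontrivial valuation $v$, value group $\Gamma$ and valuation ring $O_v$, let $E/F$ be a finite field extension, and let $R\subseteq E$ be a subring with $R\cap F=O_v$. Let $w_1:E\to M_1\cup\{\infty\}$ and $w_2:E\to M_2\cup\{\infty\}$ be quasi-valuations on $E$ extending $v$ (where $M_1,M_2$ are totally ordered abelian monoids containing $\Gamma$) such that $O_{w_1}=O_{w_2}=R$, i.e. $w_1,w_2\in\mathcal W_R$. Then $T_{w_1}=T_{w_2}$; that is, the quasi-valuation ring determines the topology, independently of the choice of its quasi-valuation.
   Context: A quasi-valuation on a ring $A$ is a function $w:A\to M\cup\{\infty\}$, where $M$ is a totally ordered abelian monoid (written additively, the order being compatible with addition) to which an element $\infty$ greater than all elements of $M$ is adjoined (with $m+\infty=\infty$), such that $w(0)=\infty$, $w(xy)\ge w(x)+w(y)$ and $w(x+y)\ge\min\{w(x),w(y)\}$ for all $x,y\in A$. If $w:E\to M\cup\{\infty\}$ is a quasi-valuation on $E$, its quasi-valuation ring is $O_w=\{x\in E\mid w(x)\ge 0\}$. ''$w$ extends $v$'' means $w|_F=v$, where $\Gamma$ is an ordered submonoid of $M$. $\mathcal W_R$ denotes the class of all quasi-valuations $w$ on $E$ extending $v$ with $O_w=R$. For such $w$ put $M^G=\{m\in M\mid \text{there exists } 0\ne y\in E \text{ with } m\le w(y)\}$, and for $x\in E$, $m\in M^G$ put $U_m^w(x)=\{y\in E\mid w(y-x)>m\}$. $T_w$ is the topology on $E$ with base $\{U_m^w(x)\mid x\in E,\ m\in M^G\}$.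 *)

(* Defs.v *)
From HB Require Import structures.
From mathcomp Require Import all_boot all_order all_algebra all_field.
From mathcomp Require Import boolp classical_sets topology.

Set Implicit Arguments.
Unset Strict Implicit.
Unset Printing Implicit Defensive.

Import Order.TTheory GRing.Theory.
Local Open Scope ring_scope.
Local Open Scope classical_set_scope.

(* The order is introduced by a mixin over nmodType, and not as a join with
   Order.Total, because HB refuses a join of Order.Total and GRing.Nmodule that
   Num.POrderedZmodule does not inherit from.
   The compatibility is the weak one: addition is monotone, but neither
   strictly monotone nor cancellative. *)
HB.mixin Record Nmodule_isOrdered M of GRing.Nmodule M := {
  omon_le : rel M;
  omon_le_refl : reflexive omon_le;
  omon_le_anti : antisymmetric omon_le;
  omon_le_trans : transitive omon_le;
  omon_le_total : total omon_le;
  omon_leD2l : forall z x y : M, omon_le x y -> omon_le (z + x) (z + y)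
}.

#[short(type="orderedMonoidType")]
HB.structure Definition OrderedMonoid :=
  { M of GRing.Nmodule M & Nmodule_isOrdered M }.

#[short(type="orderedGroupType")]
HB.structure Definition OrderedGroup :=
  { G of OrderedMonoid G & GRing.Zmodule G }.

HB.instance Definition _ (M : orderedMonoidType) :=
  Order.Le_isPOrder.Build ring_display (OrderedMonoid.sort M)
    (@omon_le_refl M) (@omon_le_anti M) (@omon_le_trans M).
HB.instance Definition _ (M : orderedMonoidType) :=
  Order.POrder_isTotal.Build ring_display (OrderedMonoid.sort M)
    (@omon_le_total M).

HB.instance Definition _ (G : orderedGroupType) :=
  Order.Total.copy (OrderedGroup.sort G)
    (OrderedMonoid.sort (G : orderedMonoidType)).

Lemma omonD2l (M : orderedMonoidType) (z x y : M) :
  x <= y -> z + x <= z + y.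
Proof. exact: omon_leD2l. Qed.

(* M with a greatest, absorbing element adjoined; None is that element. *)
Definition addtop (M : Type) := option M.
Definition Fin (M : Type) (m : M) : addtop M := Some m.
Definition addtop_map (M N : Type) (f : M -> N) : addtop M -> addtop N :=
  omap f.

Section AddTopOrder.
Variable M : orderType ring_display.
Implicit Types x y z : addtop M.

HB.instance Definition _ := Choice.on (addtop M).

Definition addtop_le x y :=
  match x, y with
  | _, None => true
  | None, Some _ => false
  | Some a, Some b => a <= b
  end.

Let addtop_le_refl : reflexive addtop_le.
Proof. by case=> /=. Qed.

Let addtop_le_anti : antisymmetric addtop_le.
Proof. by case=> [a|] [b|] //= /le_anti ->. Qed.

Let addtop_le_trans : transitive addtop_le.
Proof. by case=> [b|] [a|] [c|] //=; exact: le_trans. Qed.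

HB.instance Definition _ := Order.Le_isPOrder.Build ring_display (addtop M)
  addtop_le_refl addtop_le_anti addtop_le_trans.

Let addtop_le_total : total (<=%O : rel (addtop M)).
Proof. by case=> [a|] [b|] //; exact: le_total. Qed.

HB.instance Definition _ :=
  Order.POrder_isTotal.Build ring_display (addtop M) addtop_le_total.

Let addtop_lex1 x : x <= (None : addtop M).
Proof. by case: x. Qed.

HB.instance Definition _ :=
  Order.hasTop.Build ring_display (addtop M) addtop_lex1.

Lemma le_Fin (a b : M) : (Fin a <= Fin b) = (a <= b).
Proof. by []. Qed.

Lemma lt_Fin (a b : M) : (Fin a < Fin b) = (a < b).
Proof. by rewrite !ltNge. Qed.

Lemma Fin_lt_top (a : M) : Fin a < \top%O.
Proof. by rewrite ltNge. Qed.

End AddTopOrder.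

Section AddTopMonoid.
Variable M : nmodType.
Implicit Types x y z : addtop M.

Definition addtop_add x y : addtop M :=
  if x is Some a then if y is Some b then Some (a + b) else None else None.

Let addtop_addA : associative addtop_add.
Proof. by case=> [a|] [b|] [c|] //=; rewrite addrA. Qed.

Let addtop_addC : commutative addtop_add.
Proof. by case=> [a|] [b|] //=; rewrite addrC. Qed.

Let addtop_add0 : left_id (Fin 0) addtop_add.
Proof. by case=> [a|] //=; rewrite add0r. Qed.

HB.instance Definition _ := GRing.isNmodule.Build (addtop M)
  addtop_addA addtop_addC addtop_add0.

Lemma FinD (a b : M) : Fin (a + b) = Fin a + Fin b.
Proof. by []. Qed.

End AddTopMonoid.

Lemma addtopx (M : orderedMonoidType) (x : addtop M) : x + \top%O = \top%O.
Proof. by case: x. Qed.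

Lemma addtop_leD2l (M : orderedMonoidType) (z x y : addtop M) :
  x <= y -> z + x <= z + y.
Proof. by case: z x y => [c|] [a|] [b|] //; exact: omon_leD2l. Qed.

Record quasiValuation (A : pzRingType) (M : orderedMonoidType) :=
  QuasiValuation {
    qv_fun :> A -> addtop M;
    qv0 : qv_fun 0 = \top%O;
    qvM : forall x y, qv_fun x + qv_fun y <= qv_fun (x * y);
    qvD : forall x y, Order.min (qv_fun x) (qv_fun y) <= qv_fun (x + y)
  }.

Record valuation (F : fieldType) (G : orderedGroupType) := Valuation {
  valn_fun :> F -> addtop G;
  valn_top : forall x, (valn_fun x == \top%O) = (x == 0);
  valnM : forall x y, valn_fun (x * y) = valn_fun x + valn_fun y;
  valnD : forall x y, Order.min (valn_fun x) (valn_fun y) <= valn_fun (x + y)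
}.

Definition has_value_group (F : fieldType) (G : orderedGroupType)
  (v : valuation F G) := forall g : G, exists x : F, v x = Fin g.

Definition nontrivial_val (F : fieldType) (G : orderedGroupType)
  (v : valuation F G) := exists2 x : F, x != 0 & v x != 0 :> addtop G.

Definition val_ring (F : fieldType) (G : orderedGroupType)
  (v : valuation F G) : {pred F} := [pred x | (0 : addtop G) <= v x].

Definition qv_ring (A : pzRingType) (M : orderedMonoidType)
  (w : quasiValuation A M) : {pred A} := [pred x | (0 : addtop M) <= w x].

(* iota is the inclusion of G as an ordered submonoid of M. *)
Definition qv_extends (F : fieldType) (E : fieldExtType F)
    (G : orderedGroupType) (M : orderedMonoidType) (v : valuation F G)
    (iota : G -> M) (w : quasiValuation E M) :=
  forall a : F, w a%:A = addtop_map iota (v a).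

Definition qv_class (F : fieldType) (E : fieldExtType F)
    (G : orderedGroupType) (M : orderedMonoidType) (v : valuation F G)
    (iota : G -> M) (R : {pred E}) : set (quasiValuation E M) :=
  [set w | qv_extends v iota w /\ qv_ring w =i R].

Section QuasiValuationTopology.
Variables (E : nzRingType) (M : orderedMonoidType) (w : quasiValuation E M).

Definition qv_MG : set M := [set m | exists2 y : E, y != 0 & Fin m <= w y].

Definition qv_U (m : M) (x : E) : set E := [set y | Fin m < w (y - x)].

Definition qv_base_index : Type := (E * M)%type.
HB.instance Definition _ := Choice.on qv_base_index.
HB.instance Definition _ := isPointed.Build qv_base_index (0 : E, 0 : M).

(* E with the topology T_w; the unused argument makes the type, hence the
   canonical topology, depend on w. *)
Definition qv_space of quasiValuation E M : Type := E.
HB.instance Definition _ := Choice.on (qv_space w).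

Let D : set qv_base_index := [set i | qv_MG i.2].
Let b (i : qv_base_index) : set (qv_space w) := qv_U i.2 i.1.

Lemma qv_MG_nonempty : qv_MG !=set0.
Proof.
case w1: (w 1) => [m|].
  by exists m; exists 1; [exact: oner_neq0 | rewrite w1].
by exists 0; exists 1; [exact: oner_neq0 | rewrite w1].
Qed.

Lemma qv_U_center m x : qv_U m x x.
Proof. by rewrite /qv_U /= subrr qv0 Fin_lt_top. Qed.

Lemma qv_U_trans m x y z : qv_U m x y -> qv_U m y z -> qv_U m x z.
Proof.
rewrite /qv_U /= => xy yz; have := qvD w (z - y) (y - x).
by rewrite addrA subrK; apply: lt_le_trans; rewrite lt_min yz.
Qed.

Let b_cover : \bigcup_(i in D) b i = setT.
Proof.
apply/seteqP; split=> // x _; have [m mw] := qv_MG_nonempty.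
by exists (x, m) => //; exact: qv_U_center.
Qed.

Let b_join i j t : D i -> D j -> b i t -> b j t ->
  exists k, [/\ D k, b k t & b k `<=` b i `&` b j].
Proof.
case: i j => [x m] [y n]; rewrite /D /b /= => Dm Dn xt yt.
exists (t, Order.max m n); split => /=.
- by case: (leP m n).
- exact: qv_U_center.
- move=> z; rewrite /qv_U /= => zt.
  have [mz nz] : Fin m < w (z - t) /\ Fin n < w (z - t).
    by split; apply: le_lt_trans zt; rewrite le_Fin le_max lexx ?orbT.
  by split; [exact: qv_U_trans xt mz | exact: qv_U_trans yt nz].
Qed.

HB.instance Definition _ := isBaseTopological.Build (qv_space w) b_cover b_join.

Definition qv_topology : set (set E) := @open (qv_space w).

Lemma qv_topologyE (A : set E) : qv_topology A <->
  exists2 I : set (E * M), (forall i, I i -> qv_MG i.2)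
    & A = \bigcup_(i in I) qv_U i.2 i.1.
Proof. by split=> [[I sID <-]|[I sID ->]]; exists I. Qed.

End QuasiValuationTopology.

(* Main.v *)
Require Import Defs.
From mathcomp Require Import all_boot all_order all_algebra all_field.
From mathcomp Require Import boolp classical_sets topology.

(** The sets [x + a R], with [a] a nonzero element of [F], are expressed through
    [R] alone, and they form a neighbourhood base of the topology of every
    quasi-valuation [w] in the class of [R].  Indeed [w z >= v a] holds if and
    only if [a^-1 z] lies in [R], because multiplication by [a] shifts [w] by at
    least [v a] and multiplication by [a^-1] by at least [- v a].  So [x + a R]
    contains the ball of centre [x] and radius [v a], a legitimate radius since it
    is the value of [a].

    The substantial point is that every threshold [m] in [M^G] lies below some
    element of the value group ([qv_lt_group]), so that the ball of radius [m]
    contains such a set.  As [m <= w y] for some nonzero [y], it suffices to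
    bound [w y].  The elements of [E] whose value is an upper bound of the group form an
    [F]-subspace stable under products.  As [E / F] is algebraic, the inverse of
    [y] is a polynomial in [y], so such a subspace contains 1 as soon as it
    contains [y] ([algebraic_stable_contains1]); but [w 1 = 0] is not an
    upper bound of a nontrivial ordered group. *)

Set Implicit Arguments.
Unset Strict Implicit.
Unset Printing Implicit Defensive.

Import Order.TTheory GRing.Theory.
Local Open Scope ring_scope.
Local Open Scope classical_set_scope.

Section Valuation.
Variables (F : fieldType) (G : orderedGroupType) (v : valuation F G).

Lemma valn1 : v 1 = 0.
Proof.
have := valnM v 1 1; have := valn_top v 1; rewrite mulr1 oner_eq0.
case: (v 1) => [g|]; last by rewrite eqxx.
move=> _ [/eqP]; rewrite -{1}[g]addr0 (inj_eq (addrI g)) => /eqP <-.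
by [].
Qed.

Lemma valnV (a : F) (g : G) : v a = Fin g -> v a^-1 = Fin (- g).
Proof.
move=> va.
have a0 : a != 0 by rewrite -(valn_top v) va.
have := valnM v a a^-1; rewrite divff // valn1 va.
case: (v a^-1) => [h|//] [/eqP]; rewrite eq_sym addrC addr_eq0 => /eqP ->.
by [].
Qed.

End Valuation.

(** Since [y^-1] is a polynomial [p] in [y], the element 1 is [y p(y)], a
    combination of the positive powers of [y]. *)
Lemma algebraic_stable_contains1 (F : fieldType) (E : fieldExtType F)
    (I : set E) (y : E) :
    I 0 -> (forall x z, I x -> I z -> I (x + z)) ->
    (forall x z, I x -> I z -> I (x * z)) ->
    (forall (a : F) x, I x -> I (a *: x)) ->
  y != 0 -> I y -> I 1.
Proof.
move=> I0 ID IM IZ y0 Iy.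
have yV : y^-1 \in <<1%AS; y>>%AS by rewrite rpredV memv_adjoin.
rewrite -(divff y0) mulrC -(Fadjoin_poly_eq yV) horner_coef mulr_suml.
elim/big_ind: _ => // i _.
have /polyOverP/(_ i)/vlineP[c ->] := Fadjoin_polyOver 1%AS y y^-1.
rewrite -mulrA mulr_algl -exprSr; apply: IZ.
by elim: (i : nat) => [|k IH]; rewrite ?expr1 // exprS; exact: IM.
Qed.

Section Extension.
Variables (F : fieldType) (G : orderedGroupType) (v : valuation F G).
Variables (E : fieldExtType F) (M : orderedMonoidType).
Variables (iota : {additive G -> M}) (w : quasiValuation E M).
Hypothesis w_ext : qv_extends v iota w.

Lemma qv_scale_ge (a : F) (g h : G) (z : E) :
  v a = Fin g -> Fin (iota h) <= w z -> Fin (iota (g + h)) <= w (a *: z).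
Proof.
move=> va hz; rewrite -mulr_algl raddfD FinD.
apply: le_trans (qvM _ _ _); rewrite w_ext va.
exact: addtop_leD2l.
Qed.

(** The right-hand side does not involve [w]: only the quasi-valuation ring is
    needed to say which elements have value at least [v a]. *)
Lemma qv_ge_group (a : F) (g : G) (z : E) :
  v a = Fin g -> (Fin (iota g) <= w z) = (a^-1 *: z \in qv_ring w).
Proof.
move=> va; have a0 : a != 0 by rewrite -(valn_top v) va.
have e0 : 0 = Fin (iota 0) by rewrite raddf0.
rewrite inE; apply/idP/idP => [gz|].
  by rewrite e0 -(addNr g); apply: qv_scale_ge gz; exact: valnV.
by rewrite e0 => /(qv_scale_ge va); rewrite addr0 scalerA divff // scale1r.
Qed.

Hypothesis iota_mono : {mono iota : x y / x <= y}.
Hypothesis v_nontriv : nontrivial_val v.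

(** Algebraicity at work: otherwise [y] would lie in the set [I] of the elements
    whose value bounds the group from above, which is stable enough to contain 1;
    then every [g] and its opposite would be at most 0. *)
Lemma qv_lt_group (y : E) : y != 0 -> exists g : G, w y < Fin (iota g).
Proof.
move=> y0; apply: contrapT => noG.
pose I : set E := [set z | forall g, Fin (iota g) <= w z].
have Iy : I y by move=> g; rewrite leNgt; apply/negP => gy; apply: noG; exists g.
have I1 : I 1.
  apply: (algebraic_stable_contains1 _ _ _ _ y0 Iy).
  - by move=> g; rewrite qv0 lex1.
  - by move=> x z Ix Iz g; apply: le_trans (qvD _ _ _); rewrite le_min Ix Iz.
  - move=> x z Ix Iz g; apply: le_trans (qvM _ _ _).
    rewrite -[g]addr0 raddfD FinD; apply: le_trans (addtop_leD2l _ (Iz 0)).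
    by rewrite ![_ + Fin (iota 0)]addrC; exact: addtop_leD2l.
  - move=> a x Ix g; case va: (v a) => [h|].
      by rewrite -(subrKC h g); exact: qv_scale_ge.
    have /eqP -> : a == 0 by rewrite -(valn_top v) va.
    by rewrite scale0r qv0 lex1.
have G_le0 (g : G) : g <= (0 : G).
  by have := I1 g; rewrite -[1 : E]scale1r w_ext valn1 le_Fin iota_mono.
have [a a0 va0] := v_nontriv.
case va: (v a) => [g|]; last by move: a0; rewrite -(valn_top v) va.
have g0 : (0 : G) <= g by have := omonD2l g (G_le0 (- g)); rewrite subrr addr0.
have g_eq0 : g = 0 by apply: le_anti; rewrite G_le0 g0.
by move: va0; rewrite va g_eq0 => /eqP.
Qed.

End Extension.

Section Comparison.
Variables (F : fieldType) (G : orderedGroupType) (v : valuation F G).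
Hypotheses (vG : has_value_group v) (v_nontriv : nontrivial_val v).
Variables (E : fieldExtType F) (R : {pred E}).

(** A ball of [w1] of radius [m] contains, around each of its points, the ball
    of [w2] whose radius is any element of the value group lying above [m]. *)
Lemma qv_topology_sub (M1 M2 : orderedMonoidType)
    (iota1 : {additive G -> M1}) (iota2 : {additive G -> M2})
    (w1 : quasiValuation E M1) (w2 : quasiValuation E M2) :
    {mono iota1 : x y / x <= y} ->
    qv_class v iota1 R w1 -> qv_class v iota2 R w2 ->
  qv_topology w1 `<=` qv_topology w2.
Proof.
move=> iota1_mono [w1_ext w1R] [w2_ext w2R] A /qv_topologyE[I I_MG ->].
apply/qv_topologyE.
set B := \bigcup_(i in I) _.
exists [set j | qv_MG w2 j.2 /\ qv_U w2 j.2 j.1 `<=` B]; first by move=> j [].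
apply/seteqP; split=> [x|x [j [_ jB] /jB //]].
case=> -[c m] Icm /= xcm.
have [y y0 my] := I_MG _ Icm.
have [g yg] := qv_lt_group w1_ext iota1_mono v_nontriv y0.
have [a va] := vG g.
exists (x, iota2 g); last exact: qv_U_center.
split=> /=; first exists a%:A.
- by rewrite scaler_eq0 oner_eq0 orbF -(valn_top v) va.
- by rewrite w2_ext va.
- move=> z /ltW; rewrite (qv_ge_group w2_ext _ va) w2R -w1R.
  rewrite -(qv_ge_group w1_ext _ va) => gzx.
  exists (c, m) => //; apply: qv_U_trans xcm _.
  exact: le_lt_trans my (lt_le_trans yg gzx).
Qed.

End Comparison.

Theorem theorem2p20 (F : fieldType) (G : orderedGroupType)
  (v : valuation F G) (vG : has_value_group v) (v_nontriv : nontrivial_val v)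
  (E : fieldExtType F)
  (R : {pred E}) (R_subring : GRing.subring_closed R)
  (R_cap_F : forall a : F, (a%:A \in R) = (a \in val_ring v))
  (M1 M2 : orderedMonoidType)
  (iota1 : {additive G -> M1}) (iota1_mono : {mono iota1 : x y / x <= y})
  (iota2 : {additive G -> M2}) (iota2_mono : {mono iota2 : x y / x <= y})
  (w1 : quasiValuation E M1) (w2 : quasiValuation E M2)
  (w1_in : qv_class v iota1 R w1) (w2_in : qv_class v iota2 R w2) :
  qv_topology w1 = qv_topology w2.
Proof.
apply/seteqP; split.
  exact: qv_topology_sub iota1_mono w1_in w2_in.
exact: qv_topology_sub iota2_mono w2_in w1_in.
Qed.
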